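(* There are $2^{\aleph_0}$ non-regular $\mathscr{D}$-classes in $\operatorname{End}(\mathbb{Q},\leqslant)$.
   Context: $M=\operatorname{End}(\mathbb{Q},\leqslant)$ is the monoid, under composition, of all maps $f\colon\mathbb{Q}\to\mathbb{Q}$ such that $u\leqslant v$ implies $uf\leqslant vf$. Maps are written on the right, so $fg$ means first $f$, then $g$. Green's relations on $M$: $f\,\mathscr{L}\,g$ iff $Mf=Mg$; $f\,\mathscr{R}\,g$ iff $fM=gM$; $\mathscr{D}=\mathscr{L}\circ\mathscr{R}$ (an equivalence relation). An element $f\in M$ is regular if $fgf=f$ for some $g\in M$. If one element of a $\mathscr{D}$-class is regular then all its elements are; a $\mathscr{D}$-class is non-regular if none of its elements is regular. *)

(* Defs.v *)
From HB Require Import structures.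
From mathcomp Require Import all_boot all_order all_algebra.
From mathcomp Require Import boolp classical_sets.

Set Implicit Arguments.
Unset Strict Implicit.
Unset Printing Implicit Defensive.

Local Open Scope classical_set_scope.

Section Green.
Local Open Scope group_scope.
Variable M : monoidType.
Implicit Types f g : M.

Definition principal_left_ideal f : set M := [set h * f | h in setT].
Definition principal_right_ideal f : set M := [set f * h | h in setT].

Definition greenL f g : Prop := principal_left_ideal f = principal_left_ideal g.
Definition greenR f g : Prop := principal_right_ideal f = principal_right_ideal g.
Definition greenD f g : Prop := exists2 h, greenL f h & greenR h g.

Definition regular_elt f : Prop := exists g, f * g * f = f.

Definition greenD_class f : set M := [set g | greenD f g].
Definition greenD_classes : set (set M) := range greenD_class.

Definition nonregular_greenD_classes : set (set M) :=
  [set C | greenD_classes C /\ forall f, C f -> ~ regular_elt f].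
End Green.

Arguments greenD_classes M : clear implicits.
Arguments nonregular_greenD_classes M : clear implicits.

Section OrderEndomorphisms.
Context {d : Order.disp_t} (T : preorderType d).

Definition order_end : Type := {omorphism T -> T}.

HB.instance Definition _ := gen_eqMixin order_end.
HB.instance Definition _ := gen_choiceMixin order_end.

Implicit Types f g h : order_end.

Lemma order_endP f g : (f : T -> T) =1 g -> f = g.
Proof.
case: f g => [f [[Hf]]] [g [[Hg]]] /= /funext fg.
by rewrite fg in Hf *; rewrite (Prop_irrelevance Hf Hg).
Qed.

Definition order_end_id : order_end := @idfun T.

(* Maps act on the right: [f * g] is first [f], then [g]. *)
Definition order_end_mul f g : order_end := (g : {omorphism T -> T}) \o f.

Lemma order_end_mulA : associative order_end_mul.
Proof. by move=> f g h; apply: order_endP. Qed.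

Lemma order_end_mul1g : left_id order_end_id order_end_mul.
Proof. by move=> f; apply: order_endP. Qed.

Lemma order_end_mulg1 : right_id order_end_id order_end_mul.
Proof. by move=> f; apply: order_endP. Qed.

HB.instance Definition _ :=
  isMonoid.Build order_end order_end_mulA order_end_mul1g order_end_mulg1.
End OrderEndomorphisms.

(* Main.v *)
(* If [f] and [g] are D-related then their images are isomorphic as ordered
   sets, so the lengths of the maximal finite runs of consecutive points in the
   image are D-invariant.  Rounding down on the unit intervals [k, k+1) with
   [k] in a set B of integers, and fixing everything else, gives an
   endomorphism whose image has such runs exactly along the runs of B; hence
   every set of run lengths can be prescribed.  Composing with an embedding of
   the rationals onto a set bounded above without maximum preserves the order
   type of the image and destroys regularity: if [f k f = f], then [f (k 1)]
   bounds, and belongs to, the image of [f]. *)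
Require Import Defs.
From HB Require Import structures.
From mathcomp Require Import all_boot all_order all_algebra.
From mathcomp Require Import zify lra.
From mathcomp Require Import boolp classical_sets functions cardinality.
Import Order.TTheory GRing.Theory Num.Theory.
Local Open Scope classical_set_scope.
Local Open Scope card_scope.
Local Open Scope ring_scope.

(** * Green's relations in an arbitrary monoid *)

Section GreenFacts.
Local Open Scope group_scope.
Context {M : monoidType}.
Implicit Types f g h : M.

Lemma greenL_mul f g : greenL f g -> exists a b, f = a * g /\ g = b * f.
Proof.
rewrite /greenL => fg.
have : principal_left_ideal g f by rewrite -fg; exists 1 => //; rewrite mul1g.
have : principal_left_ideal f g by rewrite fg; exists 1 => //; rewrite mul1g.
by move=> [b _ bE] [a _ aE]; exists a, b; rewrite aE bE.
Qed.

Lemma greenR_mul f g : greenR f g -> exists c d, f = g * c /\ g = f * d.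
Proof.
rewrite /greenR => fg.
have : principal_right_ideal g f by rewrite -fg; exists 1 => //; rewrite mulg1.
have : principal_right_ideal f g by rewrite fg; exists 1 => //; rewrite mulg1.
by move=> [d _ dE] [c _ cE]; exists c, d; rewrite cE dE.
Qed.

Lemma greenD_refl f : greenD f f.
Proof. by exists f. Qed.

(** Regularity passes from [g] to [h] since [h (d k) h = g k g c = g c = h], and from [h] to [f]
    since [f (d k b) f = a h (d k) h = a h = f]. *)
Lemma greenD_regular f g : greenD f g -> regular_elt g -> regular_elt f.
Proof.
move=> [h /greenL_mul[a [b [fE hE]]] /greenR_mul[c [d [hgE ghE]]]] [k gE].
have hK : h * (d * k) * h = h by rewrite {2}hgE !mulgA -ghE gE -hgE.
exists (d * k * b); rewrite [f * _]mulgA -[_ * f]mulgA -hE [in LHS]fE.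
by rewrite -!mulgA mulgA in hK *; rewrite hK -fE.
Qed.

End GreenFacts.

(** * Runs of consecutive image points as a D-invariant *)

Section Covers.
Context {d : Order.disp_t} {T : porderType d} {X : Type}.
Implicit Types f : X -> T.

(* [f y] is the immediate successor of [f x] in the image of [f], not in [T]. *)
Definition covers f x y : Prop :=
  (f x < f y)%O /\ forall z, ~ (f x < f z < f y)%O.

(* [n] counts the steps of the run, which thus has [n.+1] points. *)
Definition has_run f n : Prop := exists c : nat -> X,
  [/\ forall i, (i < n)%N -> covers f (c i) (c i.+1),
      forall x, ~ covers f x (c 0%N)
    & forall x, ~ covers f (c n) x].

(** Runs are listed by arguments, not values, so they depend only on the strict order pulled back to
    [X]. *)
Lemma has_run_lt f g : (forall x y, (f x < f y)%O = (g x < g y)%O) ->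
  forall n, has_run f n -> has_run g n.
Proof.
move=> fg n; have cE x y : covers f x y <-> covers g x y.
  by rewrite /covers fg; split=> -[xy h]; split=> // z; move: (h z); rewrite !fg.
by move=> [c [h1 h2 h3]]; exists c; split=> [i|x|x];
  rewrite -cE; [exact: h1|exact: h2|exact: h3].
Qed.

End Covers.

(** The L-step keeps the image, with [a] and [b] exchanging arguments of equal value; the R-step
    keeps the strict order between values, by monotonicity of [c] and [e] in a total order. *)
Lemma greenD_has_run {d : Order.disp_t} {T : orderType d} (f g : order_end T) n :
  greenD f g -> has_run (f : T -> T) n -> has_run (g : T -> T) n.
Proof.
move=> [h /greenL_mul[a [b [fE hE]]] /greenR_mul[c [e [hgE ghE]]]].
have fx (x : T) : f x = h (a x) by rewrite fE.
have hx (x : T) : h x = f (b x) by rewrite {1}hE.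
have hgx (x : T) : h x = c (g x) by rewrite {1}hgE.
have ghx (x : T) : g x = e (h x) by rewrite {1}ghE.
have ltE (x y : T) : (h x < h y)%O = (g x < g y)%O.
  apply/idP/idP; rewrite !ltNge; apply: contra => le.
    by rewrite !hgx; apply: omorph_le.
  by rewrite !ghx; apply: omorph_le.
move=> [u [h1 h2 h3]]; apply: (has_run_lt (h : T -> T) _ ltE).
have cE x y : covers h (a x) (a y) <-> covers f x y.
  rewrite /covers -!fx; split=> -[xy H]; split=> // z.
    by rewrite (fx z); apply: H.
  by rewrite (hx z); apply: H.
have bE x y : covers h x y <-> covers f (b x) (b y).
  rewrite /covers -!hx; split=> -[xy H]; split=> // z.
    by rewrite (fx z); apply: H.
  by rewrite (hx z); apply: H.
(* [b] undoes [a] up to values of [f], so a cover that would extend the transported run at either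
   end pulls back to the original run. *)
have baE x : f (b (a x)) = f x by rewrite -hx -fx.
exists (fun i => a (u i)); split=> [i ltin|x|x].
- by apply/cE/h1.
- by move=> /bE; rewrite /covers baE; apply: h2.
- by move=> /bE; rewrite /covers baE; apply: h3.
Qed.

(** * Rounding down on chosen unit intervals *)

Definition partial_floor (B : int -> bool) (x : rat) : rat :=
  if B (Num.floor x) then (Num.floor x)%:~R else x.

Section PartialFloor.
Variable B : int -> bool.
Implicit Types x y : rat.
Local Notation e := (partial_floor B).

Lemma partial_floor_itv x : (Num.floor x)%:~R <= e x <= x.
Proof. by rewrite /partial_floor; case: ifP; rewrite ?lexx floor_le. Qed.

Lemma partial_floor_lt x : x < (Num.floor x)%:~R + 1.
Proof. by have := floorD1_gt x; rewrite intrD. Qed.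

Lemma floor_partial_floor x : Num.floor (e x) = Num.floor x.
Proof.
apply: floor_def; have /andP[-> h] := partial_floor_itv x.
exact: le_lt_trans h (floorD1_gt x).
Qed.

Lemma partial_floor_int k : e k%:~R = k%:~R :> rat.
Proof. by rewrite /partial_floor intrKfloor; case: ifP. Qed.

Lemma partial_floor_homo : {homo e : x y / x <= y}.
Proof.
move=> x y xy; have := le_floor xy; rewrite le_eqVlt => /predU1P[xy1|].
  by rewrite /partial_floor xy1; case: ifP.
rewrite -lezD1 -(ler_int rat) intrD => xy1.
have /andP[_ h1] := partial_floor_itv x; have /andP[h2 _] := partial_floor_itv y.
have := partial_floor_lt x; lra.
Qed.

Lemma partial_floor_addr1_gt x : e x < e (x + 1).
Proof.
have /andP[_ h1] := partial_floor_itv x.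
have /andP[h2 _] := partial_floor_itv (x + 1).
move: h2; rewrite floorDrz ?rpred1// floor1 intrD => h2.
have := partial_floor_lt x; lra.
Qed.

(** The image meets [[k, k+1)] in [k] alone if [B k], and in the whole interval otherwise, where
    density rules out successors. Integers are fixed, so [k + 1] is always attained. *)
Lemma covers_partial_floor x y :
  covers e x y <-> exists k, [/\ B k, e x = k%:~R & e y = (k + 1)%:~R].
Proof.
split=> [[exy H]|[k [Bk ex ey]]]; last first.
  rewrite /covers ex ey ltr_int ltzD1 lexx; split=> // z.
  rewrite intrD => /andP[h1 h2].
  have /andP[h3 h4] := partial_floor_itv z; have h5 := partial_floor_lt z.
  suff zk : Num.floor z = k by move: h1; rewrite /partial_floor zk Bk ltxx.
  apply/eqP; rewrite floor_eq intrD; apply/andP; split; first lra.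
  suff : (Num.floor z < k + 1)%R.
    by rewrite ltzD1 -(ler_int rat) => h6; lra.
  by rewrite -(ltr_int rat) intrD; lra.
pose k := Num.floor x.
have /andP[x1 x2] := partial_floor_itv x; have x3 := partial_floor_lt x.
have Bk : B k.
  apply/negPn/negP => Bk.
  have ex : e x = x by rewrite /partial_floor -/k (negbTE Bk).
  (* The cap [k + 1] keeps the midpoint [z] in the interval of [x], where [e] is the identity. *)
  pose u := Num.min (e y) (k%:~R + 1); pose z := (x + u) / 2%:R.
  have xu : x < u by rewrite lt_min -{1}ex exy.
  have uk : u <= k%:~R + 1 by rewrite ge_min lexx orbT.
  have uy : u <= e y by rewrite ge_min lexx.
  have zx : x < z by rewrite /z; lra.
  have zu : z < u by rewrite /z; lra.
  have zk : Num.floor z = k.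
    by apply: floor_def; rewrite intrD; apply/andP; split; [rewrite /k|]; lra.
  have ez : e z = z by rewrite /partial_floor zk (negbTE Bk).
  by apply: (H z); rewrite ez ex zx; lra.
have ex : e x = k%:~R by rewrite /partial_floor -/k Bk.
exists k; split=> //; apply/eqP; rewrite eq_le; apply/andP; split.
  rewrite leNgt; apply/negP => h; apply: (H (k + 1)%:~R).
  by rewrite partial_floor_int h ex ltr_int ltzD1 lexx.
rewrite leNgt; apply/negP => h.
have /andP[y1 y2] := partial_floor_itv y; have y3 := partial_floor_lt y.
have yk : Num.floor y = k.
  apply/eqP; rewrite eq_le; apply/andP; split.
    by rewrite -ltzD1 -(ltr_int rat); lra.
  rewrite -ltzD1 -(ltr_int rat) intrD; lra.
by move: exy; rewrite ex /partial_floor yk Bk ltxx.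
Qed.

(** At least one step is required: the first cover forces the run to start at an integer, whereas
    any interior point of an unrounded interval is a run with no steps. *)
Lemma has_run_partial_floor n : has_run e n.+1 <->
  exists k : int, [/\ forall i, (i < n.+1)%N -> B (k + i%:Z),
    ~~ B (k - 1) & ~~ B (k + n.+1%:Z)].
Proof.
split=> [[c [h1 h2 h3]]|[k [h1 h2 h3]]].
  have /covers_partial_floor[k [Bk ck _]] := h1 0%N isT.
  have ce i : (i <= n.+1)%N -> e (c i) = (k + i%:Z)%:~R.
    elim: i => [|i IHi] lein; first by rewrite addr0.
    have /covers_partial_floor[l [_ cl ->]] := h1 i lein.
    move: cl; rewrite IHi 1?ltnW// => /intr_inj <-.
    by rewrite -addrA -PoszD addn1.
  exists k; split=> [i lein||].
  - have /covers_partial_floor[l [Bl cl _]] := h1 i lein.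
    by move: cl; rewrite ce 1?ltnW// => /intr_inj ->.
  - apply/negP => Bk1; apply: (h2 (k - 1)%:~R).
    apply/covers_partial_floor; exists (k - 1).
    by rewrite partial_floor_int subrK.
  - apply/negP => Bn; apply: (h3 (k + n.+1%:Z + 1)%:~R).
    apply/covers_partial_floor; exists (k + n.+1%:Z).
    by rewrite partial_floor_int ce.
exists (fun i => (k + i%:Z)%:~R); split=> [i lein|x|x].
- apply/covers_partial_floor; exists (k + i%:Z).
  by rewrite !partial_floor_int -addn1 PoszD addrA h1.
- move=> /covers_partial_floor[l [Bl _]].
  rewrite partial_floor_int addr0 => /intr_inj kl.
  by move: h2; rewrite kl addrK Bl.
- move=> /covers_partial_floor[l [Bl]].
  by rewrite partial_floor_int => /intr_inj kl _; move: h3; rewrite kl Bl.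
Qed.

End PartialFloor.

(** * Coding a set of naturals by run lengths *)

(* For distinct [p > 0] the intervals [p ^ 2, p ^ 2 + p) are not adjacent, so
   each of them is a maximal run. *)
Definition square_runs (S : nat -> bool) (k : int) : bool :=
  `[< exists n, S n /\ (n.+1 ^ 2)%N%:Z <= k < (n.+1 ^ 2 + n.+1)%N%:Z >].

Lemma square_runsP S n :
  (exists k : int, [/\ forall i, (i < n.+1)%N -> square_runs S (k + i%:Z),
    ~~ square_runs S (k - 1) & ~~ square_runs S (k + n.+1%:Z)]) <-> S n.
Proof.
have sq i j : (i < j)%N -> (i.+1 ^ 2 + i.+1 < j.+1 ^ 2)%N by nia.
split=> [[k [h1 h2 h3]]|Sn].
  have /asboolP[m [Sm km]] := h1 0%N isT.
  have kE : k = (m.+1 ^ 2)%N%:Z.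
    apply/eqP; apply: contraNT h2 => kE; apply/asboolP; exists m; split=> //; lia.
  suff -> : n = m by [].
  have [ltnm|ltmn|//] := ltngtP n m.
  - case/negP: h3; apply/asboolP; exists m; split=> //.
    by rewrite kE -PoszD lez_nat ltz_nat leq_addr ltn_add2l ltnS ltnm.
  (* The first integer past the interval of [m] would have to lie in another interval, against the
     gaps between them. *)
  - have /asboolP[p [_]] := h1 m.+1 ltmn.
    rewrite kE -PoszD !lez_nat ltz_nat; have [lepm|ltmp] := leqP p m; nia.
exists (n.+1 ^ 2)%N%:Z; split=> [i lein||].
- apply/asboolP; exists n; split=> //; lia.
- apply/asboolPn => -[m [_]].
  by have [/sq lt_mn|/sq lt_nm|->] := ltngtP m n; lia.
- apply/asboolPn => -[m [_]].
  by have [/sq lt_mn|/sq lt_nm|->] := ltngtP m n; lia.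
Qed.

(** * Non-regular endomorphisms with prescribed runs *)

HB.instance Definition _ (B : int -> bool) :=
  Order.isOrderMorphism.Build _ _ _ _ (partial_floor B) (@partial_floor_homo B).

(** On nonnegative rationals this is [x / (1 + x)], so the image is the set of all rationals below
    1. *)
Definition bounding (x : rat) : rat := if x < 0 then x else 1 - (1 + x)^-1.

Lemma bounding_mono : {mono bounding : x y / x <= y}.
Proof.
suff lt_homo (x y : rat) : x < y -> bounding x < bounding y by apply: le_mono.
move=> xy; rewrite /bounding.
have [x0|x0] := ltP x 0; have [y0|y0] := ltP y 0 => //; last 2 first.
- lra.
- by rewrite ltrD2l ltrN2 ltf_pV2 ?ltrD2l// posrE; lra.
have : (1 + y)^-1 <= 1 by rewrite invf_le1; lra.
lra.
Qed.

Lemma bounding_lt1 x : bounding x < 1.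
Proof.
rewrite /bounding; have [x0|x0] := ltP x 0; first lra.
have : 0 < (1 + x)^-1 by rewrite invr_gt0; lra.
lra.
Qed.

HB.instance Definition _ :=
  Order.isOrderMorphism.Build _ _ _ _ bounding
    (fun x y xy => etrans (bounding_mono x y) xy).

Definition bounded_end (B : int -> bool) : order_end rat :=
  ((partial_floor B : order_end rat) * (bounding : order_end rat))%g.

Lemma bounded_endE B x : bounded_end B x = bounding (partial_floor B x).
Proof. by []. Qed.

Lemma bounded_end_nonregular B : ~ regular_elt (bounded_end B).
Proof.
move=> [k fkf].
have fk x : bounded_end B (k (bounded_end B x)) = bounded_end B x.
  by rewrite -{3}fkf.
have le1 x : bounded_end B x <= bounded_end B (k 1).
  by rewrite -(fk x); do 2!apply: omorph_le; apply/ltW/bounding_lt1.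
(* The value at [k 1] would be greatest, but shifting the argument by 1 gives a larger one. *)
have := le1 (k 1 + 1); rewrite !bounded_endE bounding_mono leNgt.
by rewrite partial_floor_addr1_gt.
Qed.

Lemma has_run_bounded_end S n :
  has_run (bounded_end (square_runs S) : rat -> rat) n.+1 <-> S n.
Proof.
rewrite -square_runsP -has_run_partial_floor.
by split; apply: has_run_lt => x y;
  rewrite bounded_endE (leW_mono bounding_mono).
Qed.

Lemma bounded_end_greenD_inj S S' :
  greenD (bounded_end (square_runs S)) (bounded_end (square_runs S')) ->
  forall n, S n -> S' n.
Proof.
move=> D n /has_run_bounded_end run.
exact/has_run_bounded_end/(@greenD_has_run _ rat _ _ _ D run).
Qed.

(** * Counting the classes *)

Lemma card_order_end_rat : [set: order_end rat] #<= [set: nat -> bool].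
Proof.
(* A map is determined by its graph, a subset of the countable set of pairs; numbers coding no pair
   are sent to [false]. *)
pose graph (f : order_end rat) (n : nat) :=
  if unpickle n is Some xy then f xy.1 == xy.2 :> rat else false.
apply/pcard_injP; exists graph => f g _ _ fg; apply: order_endP => x.
have := congr1 (fun h => h (pickle (x, f x))) fg.
by rewrite /graph pickleK /= eqxx => /esym/eqP.
Qed.

Theorem corollary3p11 :
  nonregular_greenD_classes (order_end rat) #= [set: nat -> bool].
Proof.
apply: Cantor_Bernstein.
  apply: card_le_trans card_order_end_rat.
  apply: (card_le_trans _ (card_image_le (@greenD_class (order_end rat)) setT)).
  by apply: subset_card_le => C [].
pose class S := greenD_class (bounded_end (square_runs S)).
have classN S : nonregular_greenD_classes (order_end rat) (class S).
  split=> [|f D f_reg]; first by exists (bounded_end (square_runs S)).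
  apply: (@bounded_end_nonregular (square_runs S)).
  exact: greenD_regular D f_reg.
have class_inj : injective class.
  have sub S S' : class S = class S' -> forall n, S n -> S' n.
    move=> E; apply: bounded_end_greenD_inj.
    (* Membership in [class S] is [greenD] by definition, so equal classes and reflexivity
       suffice. *)
    change (class S (bounded_end (square_runs S'))).
    by rewrite E; apply: greenD_refl.
  move=> S S' E; apply/funext => n; apply/idP/idP; exact: sub.
apply: (@card_le_trans _ _ _ (range class)); last first.
  by apply: subset_card_le => C [S _ <-].
have := inj_card_eq (A := [set: nat -> bool]) (in2W class_inj).
by rewrite card_eq_le => /andP[].
Qed.
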